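(* Let $w=(w(n))_{n=1}^\infty$ be a bounded, strictly positive sequence such that $\limsup_{n\to\infty}\frac{w(n+1)}{w(n)}\in[0,1)$. Then the Cesàro operator $\mathsf{C}$ maps $\ell_1(w)$ into itself and $\mathsf{C}\colon\ell_1(w)\to\ell_1(w)$ is a compact operator.
   Context: The discrete Cesàro operator $\mathsf{C}\colon\mathbb{C}^{\mathbb{N}}\to\mathbb{C}^{\mathbb{N}}$ is the linear map $\mathsf{C}x:=\left(\frac{x_1+\dots+x_n}{n}\right)_{n\in\mathbb{N}}$ for $x=(x_n)_{n\in\mathbb{N}}$, with $\mathbb{N}=\{1,2,\dots\}$. For a bounded, strictly positive sequence $w=(w(n))_{n=1}^\infty$, $\ell_1(w):=\{x\in\mathbb{C}^{\mathbb{N}}\colon \sum_{n=1}^\infty w(n)|x_n|<\infty\}$, a Banach space for the norm $\|x\|_{1,w}:=\sum_{n=1}^\infty w(n)|x_n|$. *)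

(* Defs.v *)
From HB Require Import structures.
From mathcomp Require Import all_boot all_order all_algebra.
From mathcomp Require Import all_classical all_reals all_analysis.
From mathcomp Require Import complex.

Set Implicit Arguments.
Unset Strict Implicit.
Unset Printing Implicit Defensive.

Import Order.TTheory GRing.Theory Num.Theory.
Import numFieldNormedType.Exports.

Local Open Scope classical_set_scope.
Local Open Scope ring_scope.
Local Open Scope complex_scope.

(* Sequences are indexed from 0: [x n] stands for the entry x_(n+1) of a
   sequence indexed by {1, 2, ...}, and likewise for the weight [w n]. *)

Section cesaro.
Context {R : realType}.

Definition cesaro_op (x : nat -> R[i]) : nat -> R[i] :=
  fun n => (\sum_(k < n.+1) x k) / n.+1%:R.

Lemma cesaro_op_is_linear : linear cesaro_op.
Proof.
move=> a x y; apply/funext => n; rewrite /cesaro_op.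
rewrite [RHS](_ : _ = a * ((\sum_(k < n.+1) x k) / n.+1%:R)
  + (\sum_(k < n.+1) y k) / n.+1%:R)//.
rewrite mulrA -mulrDl; congr (_ / _).
by rewrite mulr_sumr -big_split.
Qed.

HB.instance Definition _ :=
  GRing.isLinear.Build R[i] (nat -> R[i]) (nat -> R[i]) _ cesaro_op
    cesaro_op_is_linear.

End cesaro.

Section weighted_sum.
Context {R : realType} (w : nat -> R).

(* [Normc.normc] is the modulus of a complex number as an element of [R];
   the norm [`|z|] of [z : R[i]] is [(Normc.normc z)%:C]. *)
Definition wsum (x : nat -> R[i]) : \bar R :=
  (\sum_(0 <= n <oo) (w n * Normc.normc (x n))%:E)%E.

End weighted_sum.

Section ell1.
Context {R : realType} {w : nat -> R}.
Implicit Types x y : nat -> R[i].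

Definition ell1_pred (w_gt0 : forall n, 0 < w n) : {pred nat -> R[i]} :=
  fun x => (wsum w x < +oo)%E.

Variable w_gt0 : forall n, 0 < w n.

Let normc_ge0 (z : R[i]) : 0 <= Normc.normc z.
Proof. by case: z => a b; exact: sqrtr_ge0. Qed.

Lemma wsum_term_ge0 x n : (0 <= (w n * Normc.normc (x n))%:E)%E.
Proof. by rewrite lee_fin mulr_ge0// ltW. Qed.

Lemma wsum_ge0 x : (0 <= wsum w x)%E.
Proof. by apply: nneseries_ge0 => n _ _; exact: wsum_term_ge0. Qed.

Lemma wsumD x y : (wsum w (x + y)%R <= wsum w x + wsum w y)%E.
Proof.
rewrite /wsum -nneseriesD; try by move=> n _ _; exact: wsum_term_ge0.
apply: lee_nneseries => [n _ _|n _]; first exact: wsum_term_ge0.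
by rewrite -EFinD lee_fin -mulrDr ler_wpM2l ?le_normcD// ltW.
Qed.

Lemma wsumZ (a : R[i]) x : wsum w (a *: x) = ((Normc.normc a)%:E * wsum w x)%E.
Proof.
rewrite /wsum -nneseriesZl; last by move=> n _; exact: wsum_term_ge0.
apply: eq_eseriesr => n _; rewrite -EFinM; congr EFin.
by rewrite [(a *: x) n](_ : _ = a * x n)// Normc.normcM mulrCA.
Qed.

Lemma wsum0 : wsum w 0 = 0%E.
Proof. by apply: eseries0 => n _ _; rewrite Normc.normc0 mulr0. Qed.

Lemma ell1_submod_closed : submod_closed (ell1_pred w_gt0).
Proof.
split=> [|a x y]; rewrite !unfold_in; first by rewrite wsum0.
move=> xoo yoo; apply: (le_lt_trans (wsumD _ _)); rewrite lte_add_pinfty//.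
by rewrite wsumZ lte_mul_pinfty// lee_fin.
Qed.

HB.instance Definition _ :=
  GRing.isSubmodClosed.Build R[i] (nat -> R[i]) (ell1_pred w_gt0)
    (GRing.submod_closed_semi ell1_submod_closed).

Record ell1 := Ell1 {
  ell1_val :> nat -> R[i];
  ell1_valP : ell1_val \in ell1_pred w_gt0 }.

HB.instance Definition _ := [isSub for ell1_val].
HB.instance Definition _ := [Choice of ell1 by <:].
HB.instance Definition _ := [SubChoice_isSubLmodule of ell1 by <:].

(* A norm on a module over [R[i]] takes its values in [R[i]]. *)
Definition ell1_norm (x : ell1) : R[i] := (fine (wsum w x))%:C.

Lemma wsum_fin_num (x : ell1) : wsum w x \is a fin_num.
Proof. by rewrite ge0_fin_numE ?wsum_ge0//; exact: ell1_valP. Qed.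

Lemma ell1_normD (x y : ell1) : ell1_norm (x + y) <= ell1_norm x + ell1_norm y.
Proof.
rewrite /ell1_norm -rmorphD lecR -fineD ?wsum_fin_num//.
by apply: fine_le; rewrite ?fin_numD ?wsum_fin_num//; exact: wsumD.
Qed.

Lemma ell1_normZ (a : R[i]) (x : ell1) :
  ell1_norm (a *: x) = `|a| * ell1_norm x.
Proof.
rewrite /ell1_norm [wsum w _](_ : _ = wsum w (a *: (x : nat -> R[i])))//.
by rewrite wsumZ fineM ?wsum_fin_num// rmorphM.
Qed.

Lemma ell1_norm_eq0 (x : ell1) : ell1_norm x = 0 -> x = 0.
Proof.
case=> x0; apply/val_inj/funext => n.
have : ((w n * Normc.normc (x n))%:E <= 0)%E.
  rewrite -[leRHS](_ : wsum w x = 0%E); last first.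
    by rewrite -[LHS]fineK ?wsum_fin_num// x0.
  rewrite /wsum (nneseriesD1 (n := n))//; last by move=> k _; exact: wsum_term_ge0.
  by rewrite leeDl// nneseries_ge0// => k _ _; exact: wsum_term_ge0.
rewrite lee_fin pmulr_rle0// => xn0.
by apply: Normc.eq0_normc; apply/eqP; rewrite eq_le xn0 normc_ge0.
Qed.

HB.instance Definition _ :=
  Lmodule_isNormed.Build R[i] ell1 ell1_normD ell1_normZ ell1_norm_eq0.

Section cesaro_ell1.
Hypothesis cesaro_stable :
  forall x, x \in ell1_pred w_gt0 -> cesaro_op x \in ell1_pred w_gt0.

Definition cesaro_ell1 (x : ell1) : ell1 := Ell1 (cesaro_stable (ell1_valP x)).

Lemma cesaro_ell1_is_linear : linear cesaro_ell1.
Proof. by move=> a x y; apply/val_inj; exact: cesaro_op_is_linear. Qed.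

HB.instance Definition _ :=
  GRing.isLinear.Build R[i] ell1 ell1 _ cesaro_ell1 cesaro_ell1_is_linear.

End cesaro_ell1.

End ell1.

Definition compact_operator (K : numFieldType) (U V : normedModType K)
    (T : {linear U -> V}) : Prop :=
  forall A : set U, bounded_set A -> precompact (T @` A).

(* Main.v *)
Require Import Defs.
From HB Require Import structures.
From mathcomp Require Import all_boot all_order all_algebra.
From mathcomp Require Import all_classical all_reals all_analysis.
From mathcomp Require Import complex.
From mathcomp Require Import ring lra.
Import Order.TTheory GRing.Theory Num.Theory.
Import numFieldNormedType.Exports.
Local Open Scope classical_set_scope.
Local Open Scope ring_scope.
Local Open Scope complex_scope.

(* A ratio w(n+1)/w(n) eventually below r < 1 yields w(n) <= K r^(n-k) w(k) for
   all k <= n. Exchanging the order of summation, the tail of C x from index m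
   on then has weighted norm at most K / ((1 - r)(m + 1)) ||x||: the case m = 0
   gives boundedness of C, and the decay in m puts the image of a bounded set
   inside a set with uniformly small tails, which is compact. *)

(** * Modulus estimates and convergence of complex values *)

Lemma normc_ge0 (R : rcfType) (z : R[i]) : 0 <= Normc.normc z.
Proof. by case: z => a b; exact: sqrtr_ge0. Qed.

Lemma normcB_le (R : rcfType) (x y : R[i]) :
  Normc.normc (x - y) <= Normc.normc x + Normc.normc y.
Proof. by rewrite -[leRHS](congr2 +%R erefl (normcN y)); exact: le_normcD. Qed.

Lemma normc_sum (R : rcfType) (x : nat -> R[i]) n :
  Normc.normc (\sum_(k < n) x k) <= \sum_(k < n) Normc.normc (x k).
Proof.
elim: n => [|n IH]; first by rewrite !big_ord0 Normc.normc0.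
rewrite !big_ord_recr /=; apply: le_trans (le_normcD _ _) _.
by rewrite lerD2r.
Qed.

Lemma normc_natr (R : rcfType) n : Normc.normc (n%:R : R[i]) = n%:R.
Proof.
rewrite -[LHS](_ : Normc.normc ((1 : Rcomplex R) *+ n) = _)//.
by rewrite normcMn Normc.normc1.
Qed.

Lemma normRe_le (R : rcfType) (z : R[i]) : `|complex.Re z| <= Normc.normc z.
Proof. by case: z => a b /=; rewrite -sqrtr_sqr ler_wsqrtr// lerDl sqr_ge0. Qed.

Lemma normIm_le (R : rcfType) (z : R[i]) : `|complex.Im z| <= Normc.normc z.
Proof. by case: z => a b /=; rewrite -sqrtr_sqr ler_wsqrtr// lerDr sqr_ge0. Qed.

(** If the preimage of a neighbourhood [B] of the cluster point were not in [F], that of its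
    complement would be, and clustering would put a point in both. *)
Lemma ultra_cvg_compact (T : Type) (U : topologicalType) (F : set_system T)
    (f : T -> U) (A : set U) :
  UltraFilter F -> compact A -> F (f @^-1` A) ->
  exists l : U, f x @[x --> F] --> l.
Proof.
move=> FU cA FA; have [l [_ lcl]] := cA _ (fmap_proper_filter f _) FA.
exists l => B Bl.
have [//|FnB] := in_ultra_setVsetC (f @^-1` B) FU.
by have [z []] := lcl (~` B) B FnB Bl.
Qed.

(** Passes from two real limits, available from compact segments, to a complex one by continuity of
    the square root. *)
Lemma cvg_normcB (R : realType) (T : Type) (F : set_system T) (f : T -> R[i])
    (a b : R) : Filter F ->
  complex.Re (f x) @[x --> F] --> a -> complex.Im (f x) @[x --> F] --> b ->
  Normc.normc (f x - (a +i* b)) @[x --> F] --> 0.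
Proof.
move=> FF fa fb.
have sqrB0 (g : T -> R) (c : R) : g x @[x --> F] --> c ->
    (g x - c) ^+ 2 @[x --> F] --> 0.
  move=> gc; have : g x - c @[x --> F] --> c - c.
    by apply: cvgB => //; exact: cvg_cst.
  by rewrite subrr => gc0; rewrite -(mulr0 (0 : R)); exact: cvgM.
have : Num.sqrt ((complex.Re (f x) - a) ^+ 2 + (complex.Im (f x) - b) ^+ 2)
    @[x --> F] --> Num.sqrt (0 + 0 : R).
  by apply: continuous_cvg; [exact: sqrt_continuous|apply: cvgD; exact: sqrB0].
rewrite addr0 sqrtr0; apply: cvg_trans; apply: near_eq_cvg; apply: nearW => x /=.
by case: (f x).
Qed.

(** * Geometric decay of the weight *)

Section geometric_decay.
Context {R : realType} (w : nat -> R).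
Hypothesis w_gt0 : forall n, 0 < w n.

(** The limsup is an infimum of suprema over neighbourhoods of infinity; one of these suprema is
    already below 1 and serves as [r]. *)
Lemma limn_esup_ratio_lt1 :
  (limn_esup (fun n => (w n.+1 / w n)%:E) < 1)%E ->
  exists r, 0 < r < 1 /\
    exists N, forall n, (N <= n)%N -> w n.+1 <= r * w n.
Proof.
move=> /ereal_inf_lt[_ [V [N _ NV] <-]] s_lt1.
set s := ereal_sup _ in s_lt1.
have ratio_le n : (N <= n)%N -> ((w n.+1 / w n)%:E <= s)%E.
  by move=> Nn; apply: ereal_sup_ubound; exists n => //; exact: NV.
(* Positive ratios rule out [-oo] and [s < 1] rules out [+oo], so [s] is a positive real. *)
have : (0 < s)%E.
  by apply: lt_le_trans (ratio_le _ (leqnn N)); rewrite lte_fin divr_gt0.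
case: s s_lt1 ratio_le => [r||]//; rewrite !lte_fin => r1 ratio_le r0.
exists r; rewrite r0 r1; split=> //; exists N => n /ratio_le.
by rewrite lee_fin ler_pdivrMr.
Qed.

(** The rescaled weight [w n / r ^+ n] is nonincreasing from [N] on; the finitely many earlier
    indices are absorbed in [K]. *)
Lemma le_geometric : (limn_esup (fun n => (w n.+1 / w n)%:E) < 1)%E ->
  exists r K, [/\ 0 < r < 1, 0 <= K &
    forall k n, (k <= n)%N -> w n <= K * r ^+ (n - k) * w k].
Proof.
move=> /limn_esup_ratio_lt1[r [/andP[r0 r1] [N wS]]].
pose v n := w n / r ^+ n.
have v_gt0 n : 0 < v n by rewrite divr_gt0// exprn_gt0.
have vS n : (N <= n)%N -> v n.+1 <= v n.
  move=> Nn; rewrite ler_pdivrMr ?exprn_gt0// exprS mulrCA /v.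
  by rewrite divfK ?wS// expf_neq0// gt_eqF.
have v_le k n : (N <= k <= n)%N -> v n <= v k.
  move=> /andP[Nk]; elim: n => [|n IH]; first by rewrite leqn0 => /eqP->.
  rewrite leq_eqVlt => /orP[/eqP->//|kn].
  by apply: le_trans (IH kn); apply: vS; exact: leq_trans Nk _.
(* Sums of positive terms stand in for the maxima of [v i] and of [(v i)^-1] over [i <= N]. *)
pose V := \sum_(i < N.+1) v i; pose U := \sum_(i < N.+1) (v i)^-1.
have leV i : (i <= N)%N -> v i <= V.
  rewrite -ltnS => iN; rewrite /V (bigD1 (Ordinal iN))//= lerDl.
  by apply: sumr_ge0 => j _; exact: ltW.
have leU i : (i <= N)%N -> (v i)^-1 <= U.
  rewrite -ltnS => iN; rewrite /U (bigD1 (Ordinal iN))//= lerDl.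
  by apply: sumr_ge0 => j _; rewrite invr_ge0 ltW.
have V0 : 0 <= V by apply: sumr_ge0 => j _; exact: ltW.
have U0 : 0 <= U by apply: sumr_ge0 => j _; rewrite invr_ge0 ltW.
have vV n : v n <= V.
  have [nN|Nn] := leqP n N; first exact: leV.
  by apply: le_trans (leV _ (leqnn N)); rewrite v_le// leqnn ltnW.
(* The summand 1 serves [k >= N], by monotonicity; [V * U] serves [k < N], since [v n <= V] and
   [1 <= U * v k]. *)
exists r, (1 + V * U); rewrite r0 r1 addr_ge0 ?mulr_ge0//; split=> // k n kn.
have : v n <= (1 + V * U) * v k.
  have [Nk|kN] := leqP N k.
    apply: le_trans (v_le k n _) _; first by rewrite Nk.
    by rewrite ler_peMl ?(ltW (v_gt0 _))// lerDl mulr_ge0.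
  apply: le_trans (vV n) _; rewrite mulrDl mul1r ler_wpDl ?(ltW (v_gt0 _))//.
  rewrite -mulrA ler_peMr// -ler_pdivrMr// mul1r.
  by apply: leU; exact: ltnW.
rewrite ler_pdivrMr ?exprn_gt0// => /le_trans; apply.
have rk : r ^+ k != 0 by rewrite expf_neq0// gt_eqF.
by rewrite -{1}(subnK kn) exprD /v le_eqVlt; apply/orP; left; apply/eqP; field.
Qed.

End geometric_decay.

(** * Finite sums and the tail estimate for Cesàro means *)

Lemma ler_sum_widen_nat (R : numDomainType) (f : nat -> R) m p q :
  (forall n, 0 <= f n) -> (p <= q)%N ->
  \sum_(m <= n < p) f n <= \sum_(0 <= n < q) f n.
Proof.
move=> f0 pq; have [mp|/ltnW pm] := leqP m p; last first.
  by rewrite big_geq// sumr_ge0.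
rewrite (@big_cat_nat _ _ _ p 0 q)//= (@big_cat_nat _ _ _ m 0 p)//=.
by rewrite -addrA addrCA lerDl addr_ge0// sumr_ge0.
Qed.

Lemma exchange_big_triangle (V : nmodType) (f : nat -> nat -> V) p :
  \sum_(0 <= n < p) \sum_(0 <= k < n.+1) f n k =
  \sum_(0 <= k < p) \sum_(k <= n < p) f n k.
Proof.
elim: p => [|p IH]; first by rewrite !big_geq.
rewrite big_nat_recr//= IH [RHS]big_nat_recr//= big_nat1.
rewrite big_nat_recr//= addrA -big_split/=; congr (_ + _).
by apply: eq_big_nat => k /andP[_ kp]; rewrite [RHS]big_nat_recr// ltnW.
Qed.

Lemma sum_geometric_le (R : realFieldType) (r : R) k p : 0 < r < 1 ->
  \sum_(k <= n < p) r ^+ (n - k) <= (1 - r)^-1.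
Proof.
move=> /andP[r0 r1]; have r1' : 0 < 1 - r by rewrite subr_gt0.
rewrite -{1}[k]add0n big_addn big_mkord.
rewrite (eq_bigr (fun i : 'I__ => r ^+ i)) => [|i _]; last by rewrite addnK.
rewrite -[leRHS]mul1r ler_pdivlMr// mulrC -opprB mulNr -subrX1 opprB.
by rewrite lerBlDr lerDl exprn_ge0// ltW.
Qed.

(** The decay in [m] comes only from [1/(n+1) <= 1/(m+1)]; the outer sum is then extended down to 0,
    and the exchange leaves a geometric sum for each [k]. All sums are finite, so [x] is arbitrary
    and summability of its image can be deduced. *)
Lemma cesaro_tail_le (R : realType) (w : nat -> R) (r K : R) :
  (forall n, 0 < w n) -> 0 < r < 1 -> 0 <= K ->
  (forall k n, (k <= n)%N -> w n <= K * r ^+ (n - k) * w k) ->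
  forall (x : nat -> R[i]) m p,
  \sum_(m <= n < p) w n * Normc.normc (cesaro_op x n) <=
  K / (1 - r) / m.+1%:R * \sum_(0 <= k < p) w k * Normc.normc (x k).
Proof.
move=> w_gt0 r01 K0 w_le x m p; have /andP[r0 r1] := r01.
pose a k := w k * Normc.normc (x k).
have a0 k : 0 <= a k by rewrite mulr_ge0 ?normc_ge0 ?ltW.
pose b n := \sum_(0 <= k < n.+1) K * r ^+ (n - k) * a k.
have b0 n : 0 <= b n.
  by apply: sumr_ge0 => k _; rewrite (mulr_ge0 (mulr_ge0 _ _))// exprn_ge0// ltW.
apply: (@le_trans _ _ (m.+1%:R^-1 * \sum_(0 <= n < p) b n)).
  apply: (@le_trans _ _ (m.+1%:R^-1 * \sum_(m <= n < p) b n)); last first.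
    by rewrite ler_wpM2l// ler_sum_widen_nat.
  rewrite mulr_sumr !big_nat; apply: ler_sum => n /andP[mn _].
  rewrite /cesaro_op Normc.normcM Normc.normcV normc_natr mulrA mulrC.
  rewrite ler_pM ?invr_ge0 ?mulr_ge0 ?normc_ge0 ?(ltW (w_gt0 _))//.
    by rewrite lef_pV2 ?posrE// ler_nat.
  apply: (@le_trans _ _ (w n * \sum_(k < n.+1) Normc.normc (x k))).
    by rewrite ler_wpM2l ?normc_sum ?(ltW (w_gt0 _)).
  rewrite mulr_sumr /b big_mkord; apply: ler_sum => -[k /= kn] _.
  by rewrite /a mulrA ler_wpM2r ?normc_ge0// w_le.
rewrite [K / _ / _]mulrC -[leRHS]mulrA ler_wpM2l//.
rewrite exchange_big_triangle mulr_sumr; apply: ler_sum => k _.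
under eq_bigr do rewrite mulrAC mulrC.
rewrite -mulr_suml -/(a k) [leRHS]mulrAC mulrC ler_wpM2l ?(mulr_ge0 K0)//.
exact: sum_geometric_le.
Qed.

(** * Compactness in the weighted space *)

Section ell1_compactness.
Context {R : realType} {w : nat -> R} (w_gt0 : forall n, 0 < w n).

Lemma wsum_le (x : nat -> R[i]) (c : R) :
  (forall p, \sum_(0 <= n < p) w n * Normc.normc (x n) <= c) ->
  (wsum w x <= c%:E)%E.
Proof.
move=> xc; apply: lime_le.
  by apply: is_cvg_nneseries => n _ _; exact: wsum_term_ge0.
by apply: nearW => p; rewrite sumEFin lee_fin.
Qed.

Lemma partial_sum_le_norm (x : ell1 w_gt0) p :
  (\sum_(0 <= n < p) w n * Normc.normc (x n))%:C <= `|x|.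
Proof.
rewrite [`|x|](_ : _ = (fine (wsum w x))%:C)// lecR.
rewrite -lee_fin fineK ?wsum_fin_num// -sumEFin.
by apply: nneseries_lim_ge => n _ _; exact: wsum_term_ge0.
Qed.

Lemma ell1_norm_le (x : ell1 w_gt0) (c : R) :
  (forall p, \sum_(0 <= n < p) w n * Normc.normc (x n) <= c) -> `|x| <= c%:C.
Proof.
move=> /wsum_le xc.
rewrite [`|x|](_ : _ = (fine (wsum w x))%:C)// lecR.
by rewrite -lee_fin fineK ?wsum_fin_num.
Qed.

(* Along an ultrafilter the coordinates converge by local compactness, and the
   uniform tail bounds upgrade this to convergence in norm. *)
Lemma compact_uniform_tails (c : nat -> R) : c n @[n --> \oo] --> 0 ->
  compact [set y : ell1 w_gt0 |
    forall m p, \sum_(m <= n < p) w n * Normc.normc (y n) <= c m].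
Proof.
move=> c0; rewrite compact_ultra => F FU FS.
set S := [set y : ell1 w_gt0 | _] in FS *.
have coord_le y n : S y -> Normc.normc (y n) <= c n / w n.
  move=> /(_ n n.+1); rewrite big_nat1 => yn.
  by rewrite ler_pdivlMr// mulrC.
(* An abstract [f] covers real and imaginary parts at once. *)
have cvg_coord (f : R[i] -> R) : (forall z, `|f z| <= Normc.normc z) ->
    exists l : nat -> R, forall n,
      f ((y : ell1 w_gt0) n) @[y --> F] --> l n.
  move=> f_le.
  suff H n : exists l : R, f ((y : ell1 w_gt0) n) @[y --> F] --> l.
    by have [g Hg] := choice H; exists g.
  apply: (@ultra_cvg_compact _ _ F _ _ FU
    (@segment_compact R (- (c n / w n)) (c n / w n))).
  apply: filterS FS => y Sy /=; rewrite in_itv/= -ler_norml.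
  exact: le_trans (f_le _) (coord_le _ _ Sy).
have [a cvg_a] := cvg_coord (@complex.Re R) (@normRe_le R).
have [b cvg_b] := cvg_coord (@complex.Im R) (@normIm_le R).
pose l n := a n +i* b n.
have cvg_partial p :
    \sum_(0 <= n < p) w n * Normc.normc ((y : ell1 w_gt0) n - l n)
    @[y --> F] --> 0.
  elim: p => [|p IH].
    by under eq_fun do rewrite big_geq//; exact: cvg_cst.
  have : \sum_(0 <= n < p) w n * Normc.normc ((y : ell1 w_gt0) n - l n) +
      w p * Normc.normc ((y : ell1 w_gt0) p - l p) @[y --> F] --> 0 + w p * 0.
    apply: cvgD => //; apply: cvgM; first exact: cvg_cst.
    exact: cvg_normcB (cvg_a p) (cvg_b p).
  rewrite mulr0 addr0; apply: cvg_trans; apply: near_eq_cvg.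
  by apply: nearW => y /=; rewrite big_nat_recr.
have near_partial p e : 0 < e -> \forall y \near F,
    \sum_(0 <= n < p) w n * Normc.normc ((y : ell1 w_gt0) n - l n) < e.
  move=> e0; move/cvgrPdist_lt/(_ _ e0): (cvg_partial p).
  by apply: filterS => y; rewrite sub0r normrN => /(le_lt_trans (ler_norm _)).
have sum_tail_le (x : nat -> R[i]) m p :
    \sum_(m <= n < p) w n * Normc.normc (x n) <=
    \sum_(0 <= n < p) w n * Normc.normc (x n).
  by apply: ler_sum_widen_nat => // n; rewrite mulr_ge0 ?normc_ge0 ?ltW.
(* The limit inherits the tail bounds: comparison with some [y] in [S] that is [e]-close to [l] on
   the first [p] coordinates costs only [e]. *)
have Sl m p : \sum_(m <= n < p) w n * Normc.normc (l n) <= c m.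
  apply/ler_addgt0Pr => e e0.
  have [y [Sy ye]] := @filter_ex _ F _ _ (filterI FS (near_partial p e e0)).
  apply: le_trans (lerD (Sy m p) (le_trans (sum_tail_le _ m p) (ltW ye))).
  rewrite -big_split /=; apply: ler_sum => n _.
  rewrite -mulrDr ler_wpM2l ?(ltW (w_gt0 _))//.
  by have := normcB_le _ (y n) (y n - l n); rewrite subKr.
have ell : l \in ell1_pred w_gt0.
  by rewrite unfold_in; apply: le_lt_trans (wsum_le _ _ (Sl 0)) _; rewrite ltry.
exists (Ell1 ell); split; first exact: Sl.
(* The radius is a positive element of [R[i]], so its imaginary part vanishes. *)
apply/cvgrPdist_le => -[e ?]; rewrite ltcE/= => /andP[/eqP-> e0].
(* The tails of [y] and [l] from [m] on each get [e / 4], the head of the difference [e / 2]. *)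
have [m _ /(_ m (leqnn m))/= cm] : \forall m \near \oo, c m < e / 4.
  have e40 : 0 < e / 4 by rewrite divr_gt0.
  move/cvgrPdist_lt/(_ _ e40): c0.
  by apply: filterS => n; rewrite sub0r normrN => /(le_lt_trans (ler_norm _)).
have e20 : 0 < e / 2 by rewrite divr_gt0.
apply: filterS (filterI FS (near_partial m _ e20)) => y [Sy ye].
rewrite distrC; apply: ell1_norm_le => p.
rewrite (_ : \sum_(0 <= n < p) _ =
  \sum_(0 <= n < p) w n * Normc.normc (y n - l n))//.
(* Summing up to [maxn m p] allows a split at [m] even when [p < m]. *)
apply: (@le_trans _ _
  (\sum_(0 <= n < maxn m p) w n * Normc.normc (y n - l n))).
  apply: ler_sum_widen_nat => [n|]; last exact: leq_maxr.
  by rewrite mulr_ge0 ?normc_ge0 ?ltW.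
rewrite (big_cat_nat (leq0n m) (leq_maxl m p))/=.
have : \sum_(m <= n < maxn m p) w n * Normc.normc (y n - l n) <= c m + c m.
  apply: le_trans (lerD (Sy m (maxn m p)) (Sl m (maxn m p))).
  rewrite -big_split /=; apply: ler_sum => n _.
  rewrite -mulrDr ler_wpM2l ?(ltW (w_gt0 _))//.
  exact: normcB_le.
move: ye cm => /=; lra.
Qed.

End ell1_compactness.

(** * Application to the Cesàro operator *)

Theorem proposition2p9 (R : realType) (w : nat -> R)
  (w_gt0 : forall n, 0 < w n) (w_bounded : bounded_fun w)
  (w_limsup : (0 <= limn_esup (fun n => (w n.+1 / w n)%:E) < 1)%E) :
  exists cesaro_stable :
      forall x : nat -> R[i], x \in ell1_pred w_gt0 -> cesaro_op x \in ell1_pred w_gt0,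
    compact_operator (cesaro_ell1 cesaro_stable).
Proof.
have /andP[_ /(le_geometric _ w_gt0)[r [K [r01 K0 w_le]]]] := w_limsup.
have tail_le (x : ell1 w_gt0) (M : R) m p : `|x| <= M%:C ->
    \sum_(m <= n < p) w n * Normc.normc (cesaro_op x n) <=
    K / (1 - r) / m.+1%:R * M.
  move=> xM; apply: le_trans (cesaro_tail_le _ _ _ _ w_gt0 r01 K0 w_le x m p) _.
  rewrite ler_wpM2l//; last first.
    by rewrite -lecR; exact: le_trans (partial_sum_le_norm _ _ _) xM.
  have /andP[r0 r1] := r01.
  by rewrite !mulr_ge0// invr_ge0 ?ler0n// subr_ge0 ltW.
have stable x : x \in ell1_pred w_gt0 -> cesaro_op x \in ell1_pred w_gt0.
  move=> xl; pose x' := Ell1 xl.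
  rewrite unfold_in; apply: le_lt_trans (ltry _).
  (* The estimate at [m = 0] bounds the partial sums uniformly in [p]. *)
  by apply: wsum_le => // p; exact: (tail_le x' (fine (wsum w x)) 0 p).
(* Boundedness of [A] makes every number strictly above [M0] a bound, hence [M0 + 1]; it is real, so
   it comes from some [M] in [R]. *)
exists stable => A [M0 [M0real /(_ (M0 + 1))]].
rewrite ltrDl ltr01 => /(_ isT) AM.
have /complex_realP[M MM] : M0 + 1 \is Num.real by rewrite realD.
pose c (m : nat) := K / (1 - r) / m.+1%:R * M.
have c0 : c m @[m --> \oo] --> 0.
  rewrite -[X in _ --> X](mul0r M); apply: cvgM; last exact: cvg_cst.
  rewrite -[X in _ --> X](mulr0 (K / (1 - r))).
  by apply: cvgM; [exact: cvg_cst|exact: cvg_harmonic].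
have compact_S := compact_uniform_tails w_gt0 c c0.
apply: precompact_subset (compact_precompact (@norm_hausdorff _ _) compact_S).
by move=> _ [x Ax <-] m p; apply: tail_le; rewrite -MM; exact: AM.
Qed.
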